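(* Let $(\mathbb{X},d)$ be a Polish metric space, $\mathbb{Y}$ a standard Borel space, $\mathbb{U}$ an action space. Let $(\mathcal{T},Q)$ and $(\mathcal{T}_n,Q_n)$ be two POMDP models on these spaces ($\mathcal{T},\mathcal{T}_n$ stochastic kernels from $\mathbb{X}\times\mathbb{U}$ to $\mathbb{X}$; $Q,Q_n$ stochastic kernels from $\mathbb{X}$ to $\mathbb{Y}$), with filter kernels $\eta=\eta^{\mathcal{T},Q}$ and $\eta^{\mathcal{T}_n,Q_n}$. Then $$d_{BL}(\eta,\eta^{\mathcal{T}_n,Q_n})\le 2\left(d_{TV}(\mathcal{T}_n,\mathcal{T})+d_{TV}(Q_n,Q)\right).$$
   Context: Filter kernel. $\mathcal{P}(\mathbb{X})$ is the space of Borel probability measures on $\mathbb{X}$ with the weak topology. For a model $(\mathcal{T},Q)$, $z\in\mathcal{P}(\mathbb{X})$, $u\in\mathbb{U}$, consider the joint law of $(X_1,Y_1)$ given by $P^{\mathcal{T},Q}(dx_1,dy_1\mid z,u)=Q(dy_1\mid x_1)\int_{\mathbb{X}}\mathcal{T}(dx_1\mid x_0,u)\,z(dx_0)$. Let $P^{\mathcal{T},Q}(dy_1\mid z,u)$ be its $\mathbb{Y}$-marginal and $F^{\mathcal{T},Q}(z,u,y_1)\in\mathcal{P}(\mathbb{X})$ the regular conditional distribution of $X_1$ given $Y_1=y_1$. The filter kernel is the stochastic kernel from $\mathcal{P}(\mathbb{X})\times\mathbb{U}$ to $\mathcal{P}(\mathbb{X})$ given by $$\eta^{\mathcal{T},Q}(\cdot\mid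 z,u)=\int_{\mathbb{Y}}1_{\{F^{\mathcal{T},Q}(z,u,y)\in\,\cdot\,\}}P^{\mathcal{T},Q}(dy\mid z,u).$$ Metrics. $\|f\|_\infty=\sup|f|$ and $\|f\|_L$ is the best Lipschitz constant of $f$. $\|\mu-\nu\|_{TV}=\sup_{\|f\|_\infty\le1}(\int f\,d\mu-\int f\,d\nu)$ over measurable $f$ (no factor $1/2$). $\rho_{BL}(\mu,\nu)=\sup_{\|f\|_\infty+\|f\|_L\le1}(\int f\,d\mu-\int f\,d\nu)$. Uniform distances: $d_{TV}(\mathcal{T}_n,\mathcal{T})=\sup_{x,u}\|\mathcal{T}_n(\cdot\mid x,u)-\mathcal{T}(\cdot\mid x,u)\|_{TV}$, $d_{TV}(Q_n,Q)=\sup_x\|Q_n(\cdot\mid x)-Q(\cdot\mid x)\|_{TV}$, and $$d_{BL}(\eta,\eta')=\sup_{(z,u)\in\mathcal{P}(\mathbb{X})\times\mathbb{U}}\ \sup_{f}\left|\int f(z_1)\eta(dz_1\mid z,u)-\int f(z_1)\eta'(dz_1\mid z,u)\right|,$$ the inner supremum being over $f:\mathcal{P}(\mathbb{X})\to\mathbb{R}$ with $\|f\|_\infty+\|f\|_L\le1$, where $\mathcal{P}(\mathbb{X})$ carries the metric $\rho_{BL}$. *)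

(* Defs.v *)
From HB Require Import structures.
From mathcomp Require Import all_boot all_order all_algebra.
From mathcomp Require Import all_classical all_reals all_analysis.
From mathcomp Require Import measurable_realfun.

Set Implicit Arguments.
Unset Strict Implicit.
Unset Printing Implicit Defensive.
Import Order.TTheory GRing.Theory Num.Theory.
Import numFieldNormedType.Exports.

Local Open Scope classical_set_scope.
Local Open Scope ring_scope.
Local Open Scope ereal_scope.

(* Pointedness (nonemptiness) comes with Complete, and measurableType requires
   it as well. *)
#[short(type="completeMetricType")]
HB.structure Definition CompleteMetric (R : numDomainType) :=
  {T of CompletePseudoMetric R T & PseudoMetric_isMetric R T}.

Definition separable (T : topologicalType) : Prop :=
  exists2 D : set T, countable D & dense D.

Notation borel T := (g_sigma_algebraType (@open T)).

(* Y is isomorphic, as a measurable space, to a Polish space with its Borel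
   sigma-algebra. *)
Definition standard_borel (R : realType) d (Y : measurableType d) : Prop :=
  exists Z : completeMetricType R, separable Z /\
  exists (f : Y -> borel Z) (g : borel Z -> Y),
    [/\ cancel f g, cancel g f, measurable_fun setT f & measurable_fun setT g].

Section function_norms.
Context {R : realType} {T : Type}.
Implicit Types f : T -> R.

Definition sup_norm f : \bar R := ereal_sup (range (fun x => `|f x|%:E)).

(* +oo if f is not Lipschitz *)
Definition lip_const (dist : T -> T -> \bar R) f : \bar R :=
  ereal_inf [set L%:E | L in [set L : R | (0 <= L)%R /\
    forall x y, `|f x - f y|%:E <= L%:E * dist x y]].

Definition BL_ball (dist : T -> T -> \bar R) : set (T -> R) :=
  [set f | sup_norm f + lip_const dist f <= 1].

End function_norms.

Definition TV_dist {R : realType} {d} {T : measurableType d}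
    (mu nu : {measure set T -> \bar R}) : \bar R :=
  ereal_sup [set \int[mu]_x (f x)%:E - \int[nu]_x (f x)%:E |
    f in [set f : T -> R | measurable_fun setT f /\ sup_norm f <= 1]].

Definition TV_dist_ker {R : realType} {d d'} {S : measurableType d}
    {T : measurableType d'} (k k' : R.-pker S ~> T) : \bar R :=
  ereal_sup (range (fun s => TV_dist (k s) (k' s))).

Definition edist {R : realType} {T : metricType R} (x y : T) : \bar R :=
  (mdist x y)%:E.

Section space_of_probability_measures.
Context {R : realType} (X : completeMetricType R).

Definition bounded_continuous : Type :=
  {f : X -> R | continuous f /\ bounded_fun f}.

Definition weak_eval (mu : probability (borel X) R) :
    prod_topology (fun _ : bounded_continuous => R : topologicalType) :=
  fun f => (\int[mu]_x (proj1_sig f x))%R.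

(* The initial topology of weak_eval is the coarsest one making
   mu |-> \int f dmu continuous for every bounded continuous f. *)
Definition prob_weak : ptopologicalType := initial_topology weak_eval.

Definition prob_space : measurableType _ := borel prob_weak.

Definition prob_measure (z : prob_space) : probability (borel X) R := z.

Definition rho_BL (mu nu : prob_space) : \bar R :=
  ereal_sup [set \int[prob_measure mu]_x (f x)%:E -
                 \int[prob_measure nu]_x (f x)%:E |
    f in BL_ball (@edist R X)].

End space_of_probability_measures.

Section joint_law.
Context {R : realType} {dX : measure_display} {X : measurableType dX}.
Context {dY : measure_display} {Y : measurableType dY}.
Context {dU : measure_display} {U : measurableType dU}.
Variables (T : R.-pker (X * U)%type ~> X) (Q : R.-pker X ~> Y).
Variables (z : probability X R) (u : U).

Definition predictor (A : set X) : \bar R :=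
  \int[z]_x0 T (x0, u) A.

Let predictor0 : predictor set0 = 0.
Proof. by apply: integral0_eq => x _; rewrite measure0. Qed.

Let predictor_ge0 A : 0 <= predictor A.
Proof. by apply: integral_ge0 => x _; exact: measure_ge0. Qed.

Let measurable_transition A : measurable A ->
  measurable_fun setT (fun x0 : X => T (x0, u) A).
Proof.
move=> mA.
apply: (measurableT_comp (f := T ^~ A)); first exact: measurable_kernel.
exact: measurable_pair2.
Qed.

Let predictor_sigma_additive : semi_sigma_additive predictor.
Proof.
move=> F mF tF mUF.
rewrite (_ : predictor (\bigcup_n F n) =
    \int[z]_x0 \sum_(n <oo) T (x0, u) (F n)); last first.
  apply: eq_integral => x _.
  by apply/esym/cvg_lim => //; exact: measure_semi_sigma_additive.
rewrite integral_nneseries//; last by move=> n; exact: measurable_transition.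
by apply: is_cvg_nneseries => n _ _; exact: predictor_ge0.
Qed.

HB.instance Definition _ := isMeasure.Build _ _ R predictor
  predictor0 predictor_ge0 predictor_sigma_additive.

(* Q(dy1 | x1) predictor(dx1) *)
Definition joint_law (C : set (X * Y)) : \bar R :=
  \int[predictor]_x1 Q x1 (xsection C x1).

Let joint_law0 : joint_law set0 = 0.
Proof. by apply: integral0_eq => x _; rewrite xsection0 measure0. Qed.

Let joint_law_ge0 C : 0 <= joint_law C.
Proof. by apply: integral_ge0 => x _; exact: measure_ge0. Qed.

Let joint_law_sigma_additive : semi_sigma_additive joint_law.
Proof.
move=> F mF tF mUF.
rewrite (_ : joint_law (\bigcup_n F n) =
    \int[predictor]_x1 \sum_(n <oo) Q x1 (xsection (F n) x1)); last first.
  apply: eq_integral => x _; apply/esym/cvg_lim => //.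
  rewrite xsection_bigcup; apply: measure_sigma_additive.
    by move=> n; exact: measurable_xsection.
  exact: trivIset_xsection.
rewrite integral_nneseries//; last first.
  by move=> n; apply: measurable_fun_xsection_finite_kernel; rewrite inE.
by apply: is_cvg_nneseries => n _ _; exact: joint_law_ge0.
Qed.

HB.instance Definition _ := isMeasure.Build (measure_prod_display (dX, dY))
  (X * Y)%type R joint_law
  joint_law0 joint_law_ge0 joint_law_sigma_additive.

Definition obs_law : set Y -> \bar R := pushforward joint_law snd.

Let obs_law0 : obs_law set0 = 0.
Proof. by rewrite /obs_law /pushforward preimage_set0 measure0. Qed.

Let obs_law_ge0 B : 0 <= obs_law B.
Proof. exact: joint_law_ge0. Qed.

Let obs_law_sigma_additive : semi_sigma_additive obs_law.
Proof.
move=> F mF tF mUF; rewrite /obs_law /pushforward preimage_bigcup.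
have mpre B : measurable B -> measurable (@snd X Y @^-1` B).
  by move=> mB; rewrite -[X in measurable X]setTI; exact: measurable_snd.
apply: measure_semi_sigma_additive.
- by move=> n; exact: mpre.
- apply/trivIsetP => /= i j _ _ ij; rewrite -preimage_setI.
  by move/trivIsetP : tF => /(_ _ _ _ _ ij) ->//; rewrite preimage_set0.
- by rewrite -preimage_bigcup; exact: mpre.
Qed.

HB.instance Definition _ := isMeasure.Build _ _ R obs_law
  obs_law0 obs_law_ge0 obs_law_sigma_additive.

End joint_law.

Section filter.
Context {R : realType} {X : completeMetricType R}.
Context {dY : measure_display} {Y : measurableType dY}.
Context {dU : measure_display} {U : measurableType dU}.
Variables (T : R.-pker (borel X * U)%type ~> borel X).
Variables (Q : R.-pker borel X ~> Y).

(* F is a version of the regular conditional distribution of X1 given Y1. *)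
Definition regular_conditional (z : prob_space X) (u : U)
    (F : Y -> prob_space X) : Prop :=
  (forall A : set (borel X), measurable A ->
     measurable_fun setT (fun y => prob_measure (F y) A)) /\
  (forall (A : set (borel X)) (B : set Y), measurable A -> measurable B ->
     joint_law T Q (prob_measure z) u (A `*` B) =
       \int[obs_law T Q (prob_measure z) u]_(y in B) prob_measure (F y) A).

(* The conditional distributions are determined only up to null sets, so that
   the filter kernel is introduced by its characterization; the value of
   eta (z, u) does not depend on the version F. *)
Definition is_filter_kernel
    (eta : R.-pker (prob_space X * U)%type ~> prob_space X) : Prop :=
  exists F : prob_space X -> U -> Y -> prob_space X,
    (forall z u, regular_conditional z u (F z u)) /\
    (forall z u (A : set (prob_space X)), measurable A ->
       eta (z, u) A =
         \int[obs_law T Q (prob_measure z) u]_y (\1_A (F z u y))%:E).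

End filter.

Definition BL_dist_ker {R : realType} {X : completeMetricType R}
    {d} {S : measurableType d} (k k' : R.-pker S ~> prob_space X) : \bar R :=
  ereal_sup (range (fun s =>
    ereal_sup [set `| \int[k s]_z (f z)%:E - \int[k' s]_z (f z)%:E | |
      f in BL_ball (@rho_BL R X)])).

(* Main.v *)
Require Import Defs.
From HB Require Import structures.
From mathcomp Require Import all_boot all_order all_algebra.
From mathcomp Require Import all_classical all_reals all_analysis.
From mathcomp Require Import measurable_realfun.
From mathcomp Require Import lra ring.
Set Implicit Arguments.
Unset Strict Implicit.
Unset Printing Implicit Defensive.
Import Order.TTheory GRing.Theory Num.Theory.
Import numFieldNormedType.Exports.
Local Open Scope classical_set_scope.
Local Open Scope ring_scope.

(* Fix (z, u) and write P, P' for the two joint laws of (X1, Y1), mu, mu' for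
   their Y-marginals and D for the sum of the two uniform total variation
   distances; integrating out one kernel at a time shows that P and P' (hence mu
   and mu') are at distance at most D. If |f| <= a and f is b-Lipschitz, then
     |int f(F) dmu - int f(F') dmu'|
       <= |int f(F) dmu - int f(F) dmu'| + int |f(F) - f(F')| dmu'
       <= a D + b int rho_BL(F, F') dmu'.
   A measurable, nearly optimal choice of the test function in rho_BL(F y, F' y)
   gives phi(x, y) with |phi| <= 1 and
     rho_BL(F y, F' y) <= int phi(., y) d(F y) - int phi(., y) d(F' y) + e.
   Replacing mu' by mu in the first term costs D, and by disintegration what
   remains is int phi dP - int phi dP' <= D. The total is
   (a + 2 b) D <= 2 D.
   Separability of X makes this rigorous: rho_BL is a supremum over a countable
   family of test functions, and the probability measures have a countable
   rho_BL-dense subset, so that f and f(F) are measurable. *)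

(** * Mixtures of kernels *)

Section bounded_integrals.
Context {R : realType} {d} {T : measurableType d}.
Variable m : {measure set T -> \bar R}.
Hypothesis mT : m setT = 1%E.
Implicit Types f g : T -> R.

Lemma bounded_integrable f (M : R) : measurable_fun setT f ->
  (forall x, `|f x| <= M) -> m.-integrable setT (EFin \o f).
Proof.
move=> mf fM; apply: measurable_bounded_integrable => //;
  first by rewrite mT ltry.
exists M; split; first exact: num_real.
by move=> N MN x _ /=; rewrite (le_trans (fM x)) ?ltW.
Qed.

Lemma integral_EFin_bounded f (M : R) : measurable_fun setT f ->
  (forall x, `|f x| <= M) -> (\int[m]_x (f x)%:E = (\int[m]_x f x)%:E)%E.
Proof.
move=> mf fM; rewrite /Rintegral fineK//.
by apply: integrable_fin_num => //; exact: bounded_integrable fM.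
Qed.

Lemma norm_Rintegral_le f (M : R) : measurable_fun setT f ->
  (forall x, `|f x| <= M) -> `|\int[m]_x f x| <= M.
Proof.
move=> mf fM; have fi := bounded_integrable mf fM.
apply: (le_trans (le_normr_Rintegral _ fi)) => //.
have mnf : measurable_fun setT (fun x => `|f x|) by exact: measurableT_comp.
apply: (@le_trans _ _ (\int[m]_x (cst M x))).
  apply: le_Rintegral => //.
  - by apply: (@bounded_integrable _ M) => // x; rewrite normr_id.
  - by apply: (@bounded_integrable _ `|M|) => // x.
by rewrite Rintegral_cst// mT mulr1.
Qed.

Lemma Rintegral_image d' (S : measurableType d')
    (m' : {measure set S -> \bar R}) (h : T -> S) (f : S -> R) (M : R) :
  (forall A, measurable A -> m' A = m (h @^-1` A)) ->
  measurable_fun setT h -> measurable_fun setT f -> (forall x, `|f x| <= M) ->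
  \int[m']_y f y = \int[m]_x f (h x).
Proof.
move=> m'E mh mf fM; rewrite /Rintegral.
rewrite (eq_measure_integral (pushforward m h)); last by move=> A mA _; exact: m'E.
rewrite (integral_pushforward (f := EFin \o f) mh)//.
  exact/measurable_EFinP.
rewrite preimage_setT; apply: (@bounded_integrable (f \o h) M) => //.
  exact: measurableT_comp mf mh.
by move=> x; exact: fM.
Qed.

End bounded_integrals.

(** Measurability of kernel integrals is available for nonnegative integrands. The shift by [M]
    makes [f] nonnegative and changes each integral by the constant [M], since every [l s] has mass
    one. *)
Lemma measurable_Rintegral_kernel {R : realType} {dS dT}
    {S : measurableType dS} {T : measurableType dT}
    (l : S -> {measure set T -> \bar R}) (f : T -> R) (M : R) :
  (forall s, l s setT = 1%E) ->
  (forall A, measurable A -> measurable_fun setT (l ^~ A)) ->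
  measurable_fun setT f -> (forall t, `|f t| <= M) ->
  measurable_fun setT (fun s => \int[l s]_t f t).
Proof.
move=> lT ml mf fM.
have -> : (fun s => \int[l s]_t f t) = (fun s => \int[l s]_t (f t + M) - M).
  apply/funext => s; rewrite RintegralD//; last 2 first.
  - exact: bounded_integrable fM.
  - by apply: (@bounded_integrable _ _ _ _ _ _ `|M|).
  by rewrite Rintegral_cst// lT mulr1 addrK.
apply: measurable_funB => //.
apply: measurableT_comp => //.
apply: (@measurable_fun_integral_kernel _ _ _ _ _ l ml) => //.
- by move=> t; rewrite lee_fin; have := fM t; rewrite ler_norml; lra.
- by apply/measurable_EFinP; exact: measurable_funD.
Qed.

Section mixture.
Context {R : realType} {dS dT dZ} {S : measurableType dS}
  {T : measurableType dT} {Z : measurableType dZ}.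
Variables (k : R.-pker S ~> T) (h : S * T -> Z).
Hypothesis mh : measurable_fun setT h.

Let mhs s : measurable_fun setT (fun t => h (s, t)).
Proof. exact: measurableT_comp mh (pair1_measurable s). Qed.

Let xsection_setT s : xsection (h @^-1` setT) s = setT.
Proof. by apply/seteqP; split => t //= _; rewrite /xsection/= inE. Qed.

Let mh' : measurable_fun setT (fun p : unit * S * T => h (p.1.2, p.2)).
Proof.
apply: (measurableT_comp mh); apply: measurable_fun_pair => //.
exact: (measurableT_comp measurable_snd measurable_fst).
Qed.

(* integral_kcomp composes kernels parameterized by a first factor: here unit. *)
Definition lift_kernel (us : unit * S) : {measure set T -> \bar R} := k us.2.

Let measurable_lift_kernel A : measurable A ->
  measurable_fun setT (lift_kernel ^~ A).
Proof.
by move=> mA; apply: measurableT_comp (measurable_kernel k _ mA) _.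
Qed.

HB.instance Definition _ := isKernel.Build _ _ _ _ _ lift_kernel
  measurable_lift_kernel.

HB.instance Definition _ := Kernel_isProbability.Build _ _ _ _ _ lift_kernel
  (fun us => prob_kernel us.2).

(** The law of [h (s, t)] when [t] has law [k s]. Writing it as a composition with the Dirac kernel
    at [h] yields its measurability in [s] for free. *)
Let push_kernel : R.-sfker (unit * S)%type ~> Z :=
  [the R.-sfker _ ~> _ of mkcomp lift_kernel (kdirac mh')].

Let push_kernelE us A : measurable A ->
  push_kernel us A = k us.2 (xsection (h @^-1` A) us.2).
Proof.
move=> mA.
have mhA : measurable (xsection (h @^-1` A) us.2).
  by apply: measurable_xsection; rewrite -[X in measurable X]setTI; exact: mh.
rewrite -[X in _ = k _ X]setIT -integral_indic//.
apply: eq_integral => t _.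
rewrite /kdirac/= diracE indicE; congr ((nat_of_bool _)%:R%:E).
by apply/idP/idP; rewrite !inE /xsection/= inE.
Qed.

Let Rintegral_push_kernel us (f : Z -> R) (M : R) : measurable_fun setT f ->
  (forall z, `|f z| <= M) ->
  \int[push_kernel us]_z f z = \int[k us.2]_t f (h (us.2, t)).
Proof.
apply: Rintegral_image => //; first exact: prob_kernel.
move=> A mA; rewrite push_kernelE//.
by congr (k _ _); apply/seteqP; split => t /=; rewrite /xsection/= inE.
Qed.

(** The integrand depends on [s] as well; passing to the image law [push_kernel] moves this
    dependence into the kernel, where the previous measurability lemma applies. *)
Lemma measurable_Rintegral_section (f : Z -> R) (M : R) :
  measurable_fun setT f -> (forall z, `|f z| <= M) ->
  measurable_fun setT (fun s => \int[k s]_t f (h (s, t))).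
Proof.
move=> mf fM; rewrite (_ : (fun _ => _) =
    (fun s => \int[push_kernel (tt, s)]_z f z)); last first.
  by apply/funext => s; rewrite (Rintegral_push_kernel _ mf fM).
apply: (measurable_Rintegral_kernel _ _ mf fM).
- by move=> s; rewrite push_kernelE// xsection_setT prob_kernel.
- move=> A mA; apply: measurableT_comp (measurable_kernel push_kernel _ mA) _.
  exact: pair1_measurable.
Qed.

Variable nu : {measure set S -> \bar R}.
Hypothesis nuT : nu setT = 1%E.

Definition const_kernel (_ : unit) : {measure set S -> \bar R} := nu.

HB.instance Definition _ := isKernel.Build _ _ _ _ _ const_kernel
  (fun A _ => @measurable_cst _ _ _ _ _ (nu A)).

HB.instance Definition _ := Kernel_isProbability.Build _ _ _ _ _ const_kernel
  (fun _ => nuT).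

(* It suffices to know m on a pi-system G. *)
Lemma Rintegral_mixture (m : {measure set Z -> \bar R}) (G : set (set Z)) :
  measurable = <<s G >> -> setI_closed G -> G setT ->
  (forall A, G A -> m A = \int[nu]_s k s (xsection (h @^-1` A) s))%E ->
  forall (f : Z -> R) (M : R), measurable_fun setT f ->
    (forall z, `|f z| <= M) ->
  \int[m]_z f z = \int[nu]_s \int[k s]_t f (h (s, t)).
Proof.
move=> GE GI GT mE f M mf fM.
have GM A : G A -> measurable A by rewrite GE; exact: sub_sigma_algebra.
(* The mixture itself, as a kernel composition. It agrees with [m] on the pi-system [G], hence on
   all measurable sets, both being finite. *)
pose m' : {measure set Z -> \bar R} := mkcomp const_kernel push_kernel tt.
have m'E A : measurable A ->
    m' A = (\int[nu]_s k s (xsection (h @^-1` A) s))%E.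
  by move=> mA; apply: eq_integral => s _; exact: push_kernelE.
have m'T : m' setT = 1%E.
  rewrite m'E//; under eq_integral do rewrite xsection_setT prob_kernel.
  by rewrite integral_cst// nuT mule1.
have mm' A : measurable A -> m A = m' A.
  apply: (measure_unique G (fun _ => setT)) => //.
  - by rewrite bigcup_const.
  - by move=> B GB; rewrite mE// m'E//; exact: GM.
  - by move=> _; rewrite (mE _ GT) -m'E// m'T ltry.
have mT : m setT = 1%E by rewrite mm'.
have qT us : push_kernel us setT = 1%E.
  by rewrite push_kernelE// xsection_setT prob_kernel.
(* The nonnegative case is the integral formula for composed kernels; the general case follows from
   it by adding [M] to [f] and removing it at the end. *)
have ge0 (g : Z -> R) N : measurable_fun setT g -> (forall z, 0 <= g z <= N) ->
    \int[m]_z g z = \int[nu]_s \int[push_kernel (tt, s)]_z g z.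
  move=> mg g0; rewrite /Rintegral; congr fine.
  rewrite (eq_measure_integral m'); last by move=> A mA _; exact: mm'.
  rewrite (integral_kcomp const_kernel push_kernel tt)//; last 2 first.
  - by move=> z; rewrite lee_fin; case/andP: (g0 z).
  - exact/measurable_EFinP.
  apply: eq_integral => s _; rewrite fineK//.
  apply: integrable_fin_num => //; apply: (@bounded_integrable _ _ _ _ _ _ N) => //.
  by move=> t; rewrite ger0_norm//; case/andP: (g0 t).
have fM1 z : 0 <= f z + M <= M + M.
  by have := fM z; rewrite ler_norml; lra.
have iM d0 (T0 : measurableType d0) (n : {measure set T0 -> \bar R}) :
    n setT = 1%E -> n.-integrable setT (EFin \o cst M).
  by move=> nT; apply: (@bounded_integrable _ _ _ _ _ _ `|M|).
transitivity (\int[nu]_s \int[push_kernel (tt, s)]_z f z); last first.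
  by apply: eq_Rintegral => s _; exact: Rintegral_push_kernel fM.
transitivity (\int[m]_z (f z + M) - M).
  rewrite RintegralD//; [|exact: bounded_integrable fM|exact: iM].
  by rewrite Rintegral_cst// mT mulr1 addrK.
rewrite (ge0 _ _ (measurable_funD mf (measurable_cst M)) fM1).
under eq_Rintegral => s _.
  rewrite RintegralD//; [|exact: bounded_integrable fM|exact: iM].
  rewrite Rintegral_cst// qT mulr1; over.
rewrite RintegralD//; last 2 first.
- apply: (@bounded_integrable _ _ _ _ _ _ M) => //.
  + under eq_fun do rewrite (Rintegral_push_kernel _ mf fM).
    exact: measurable_Rintegral_section mf fM.
  + by move=> s; exact: norm_Rintegral_le.
- exact: iM.
by rewrite Rintegral_cst// nuT mulr1 addrK.
Qed.

End mixture.

(** * Joint laws and total variation *)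

Lemma smallest_measurable d (T : measurableType d) :
  @measurable d T = <<s @measurable d T >>.
Proof. by rewrite sigma_algebra_id//; exact: sigma_algebra_measurable. Qed.

Section joint_law_integrals.
Context {R : realType} {dX dY dU} {X : measurableType dX}
  {Y : measurableType dY} {U : measurableType dU}.
Variables (T : R.-pker (X * U)%type ~> X) (Q : R.-pker X ~> Y).
Variables (z : probability X R) (u : U).

Definition transition (x0 : X) : {measure set X -> \bar R} := T (x0, u).

Let measurable_transition A : measurable A ->
  measurable_fun setT (transition ^~ A).
Proof.
move=> mA; apply: (measurableT_comp (f := T ^~ A)).
  exact: measurable_kernel.
exact: pair2_measurable.
Qed.

HB.instance Definition _ := isKernel.Build _ _ _ _ _ transition
  measurable_transition.

HB.instance Definition _ := Kernel_isProbability.Build _ _ _ _ _ transition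
  (fun x0 => prob_kernel (x0, u)).

Lemma predictor_setT : predictor T z u setT = 1%E.
Proof.
rewrite /predictor; under eq_integral do rewrite prob_kernel.
by rewrite integral_cst// mul1e; exact: probability_setT.
Qed.

Lemma Rintegral_predictor (f : X -> R) (M : R) : measurable_fun setT f ->
  (forall x, `|f x| <= M) ->
  \int[predictor T z u]_x f x = \int[z]_x0 \int[T (x0, u)]_x f x.
Proof.
apply: (@Rintegral_mixture _ _ _ _ _ _ _ transition snd _ z _ _ measurable) => //.
- exact: probability_setT.
- exact: smallest_measurable.
- by move=> A B mA mB; exact: measurableI.
- move=> A mA; apply: eq_integral => x _; congr (T _ _).
  by apply/seteqP; split => y /=; rewrite /xsection/= inE.
Qed.

Lemma joint_law_setT : joint_law T Q z u setT = 1%E.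
Proof.
rewrite /joint_law (_ : (fun _ => _) = cst 1%E).
  by rewrite integral_cst// mul1e; exact: predictor_setT.
apply/funext => x; rewrite (_ : xsection _ _ = setT) ?prob_kernel//.
by apply/seteqP; split => t //= _; rewrite /xsection/= inE.
Qed.

Lemma Rintegral_joint_law (f : X * Y -> R) (M : R) : measurable_fun setT f ->
  (forall p, `|f p| <= M) ->
  \int[joint_law T Q z u]_p f p =
  \int[predictor T z u]_x \int[Q x]_y f (x, y).
Proof.
apply: (@Rintegral_mixture _ _ _ _ _ _ _ Q id _ _ _ _ measurable) => //.
- exact: predictor_setT.
- exact: smallest_measurable.
- by move=> A B mA mB; exact: measurableI.
Qed.

Lemma obs_law_setT : obs_law T Q z u setT = 1%E.
Proof. by rewrite /obs_law /pushforward preimage_setT joint_law_setT. Qed.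

Lemma Rintegral_obs_law (f : Y -> R) (M : R) : measurable_fun setT f ->
  (forall y, `|f y| <= M) ->
  \int[obs_law T Q z u]_y f y = \int[joint_law T Q z u]_p f p.2.
Proof. by apply: Rintegral_image => //; exact: joint_law_setT. Qed.

(** A conditional law is specified on rectangles only, but these form a generating pi-system, so the
    mixture lemma extends the identity to bounded functions. The swap [h] is there because a mixture
    lists the conditioning variable first. *)
Lemma Rintegral_disintegration (F : R.-pker Y ~> X) :
  (forall A B, measurable A -> measurable B -> joint_law T Q z u (A `*` B) =
    \int[obs_law T Q z u]_(y in B) F y A)%E ->
  forall (f : X * Y -> R) (M : R), measurable_fun setT f ->
  (forall p, `|f p| <= M) ->
  \int[joint_law T Q z u]_p f p =
  \int[obs_law T Q z u]_y \int[F y]_x f (x, y).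
Proof.
move=> FE.
pose h (p : Y * X) := (p.2, p.1).
have mh : measurable_fun setT h by exact: measurable_fun_pair.
apply: (Rintegral_mixture (h := h) _ _
  (G := [set A `*` B | A in measurable & B in measurable])) => //.
- exact: obs_law_setT.
- by rewrite measurable_prod_measurableType.
- move=> _ _ [X1 mX1 [X2 mX2 <-]] [Y1 mY1 [Y2 mY2 <-]].
  exists (X1 `&` Y1); first exact: measurableI.
  by exists (X2 `&` Y2); [exact: measurableI|rewrite setXI].
- by exists setT => //; exists setT => //; rewrite setXTT.
- move=> _ [A mA [B mB <-]]; rewrite [LHS](FE A B mA mB) [LHS]integral_mkcond.
  apply: eq_integral => y _; rewrite patchE; case: ifPn => yB.
    congr (F y _); apply/seteqP; split => x /=; rewrite /xsection/= inE//=.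
      by move=> Ax; split => //; exact: set_mem.
    by case.
  rewrite (_ : xsection _ _ = set0) ?measure0//.
  apply/seteqP; split => x //=; rewrite /xsection/= inE/= => -[_ yB'].
  by move: yB; rewrite mem_set.
Qed.

End joint_law_integrals.

Lemma TV_dist_ge_Rintegral {R : realType} {d} {T : measurableType d}
    (mu nu : {measure set T -> \bar R}) (f : T -> R) :
  mu setT = 1%E -> nu setT = 1%E -> measurable_fun setT f ->
  (forall x, `|f x| <= 1) ->
  ((\int[mu]_x f x - \int[nu]_x f x)%:E <= TV_dist mu nu)%E.
Proof.
move=> mu1 nu1 mf f1; rewrite EFinB.
rewrite -(integral_EFin_bounded mu1 mf f1) -(integral_EFin_bounded nu1 mf f1).
apply: ereal_sup_ubound; exists f => //; split => //.
by apply: ge_ereal_sup => _ [x _ <-]; rewrite lee_fin.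
Qed.

Lemma sup_norm_leP {R : realType} {T : Type} (f : T -> R) (M : R) :
  (sup_norm f <= M%:E)%E -> forall x, `|f x| <= M.
Proof.
move=> fM x; rewrite -lee_fin; apply: le_trans fM.
by apply: ereal_sup_ubound; exists x.
Qed.

(** Replaces the extended supremum by a real constant with a usable two-sided bound. It is finite
    because the integrals of a test function against two probabilities differ by at most 2. *)
Lemma TV_dist_kerP {R : realType} {d d'} {S : measurableType d}
    {T : measurableType d'} (k k' : R.-pker S ~> T) :
  exists2 c : R, TV_dist_ker k k' = c%:E &
    0 <= c /\ forall s (f : T -> R) (M : R), measurable_fun setT f ->
      (forall x, `|f x| <= M) ->
      `|\int[k s]_x f x - \int[k' s]_x f x| <= M * c.
Proof.
have kT s : k s setT = 1%E by exact: prob_kernel.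
have kT' s : k' s setT = 1%E by exact: prob_kernel.
have le2 : (TV_dist_ker k k' <= 2%:E)%E.
  apply: ge_ereal_sup => _ [s _ <-]; apply: ge_ereal_sup => _ [f [mf fn] <-].
  have f1 := sup_norm_leP fn.
  rewrite (integral_EFin_bounded (kT s) mf f1).
  rewrite (integral_EFin_bounded (kT' s) mf f1) -EFinB lee_fin.
  have := norm_Rintegral_le (kT s) mf f1; have := norm_Rintegral_le (kT' s) mf f1.
  by rewrite !ler_norml; lra.
have ge s (f : T -> R) : measurable_fun setT f -> (forall x, `|f x| <= 1) ->
    ((\int[k s]_x f x - \int[k' s]_x f x)%:E <= TV_dist_ker k k')%E.
  move=> mf f1; apply: (le_trans (TV_dist_ge_Rintegral (kT s) (kT' s) mf f1)).
  by apply: ereal_sup_ubound; exists s.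
have ge0 : (0 <= TV_dist_ker k k')%E.
  apply: le_trans (ge point (cst 0) _ _) => //; last by move=> x; rewrite normr0.
  by rewrite !Rintegral_cst// !mul0r subr0.
have [c cE] : exists c : R, TV_dist_ker k k' = c%:E.
  exists (fine (TV_dist_ker k k')); rewrite fineK// ge0_fin_numE//.
  exact: le_lt_trans le2 (ltry _).
rewrite cE in le2 ge ge0 *.
exists c => //; split; first by rewrite -lee_fin.
move=> s f M mf fM.
(* Normalization to the unit ball. If [M = 0], then [M^-1 = 0] and both [f] and [g] vanish, so
   [f = M * g] in all cases. *)
pose g x := f x * M^-1.
have M0 : 0 <= M by apply: le_trans (fM point).
have mg : measurable_fun setT g by exact: measurable_funM.
have g1 x : `|g x| <= 1.
  rewrite normrM normfV (ger0_norm M0).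
  have [->|Mn0] := eqVneq M 0; first by rewrite invr0 mulr0.
  by rewrite ler_pdivrMr ?mul1r// lt_neqAle eq_sym Mn0.
have fE : f = (fun x => M * g x).
  apply/funext => x; rewrite /g.
  have [M00|Mn0] := eqVneq M 0; last by field.
  by rewrite M00 mul0r; apply/eqP; rewrite -normr_le0 -M00.
rewrite {mf fM}fE.
rewrite !RintegralZl//; try by apply: bounded_integrable g1.
rewrite -mulrBr normrM (ger0_norm M0) ler_wpM2l//.
(* The supremum bounds signed differences only; the test function [- g] supplies the other half of
   the absolute value. *)
have mg' : measurable_fun setT (fun x => - 1 * g x) by exact: measurable_funM.
have := ge s (fun x => - 1 * g x) mg' _.
rewrite !RintegralZl//; try by apply: bounded_integrable g1.
rewrite lee_fin => ge'; have := ge s g mg g1; rewrite lee_fin => ge1.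
have {ge'} := ge' _; rewrite ler_norml ge1 andbT => ge'.
have : -1 * (\int[k s]_x g x) - -1 * (\int[k' s]_x g x) <= c.
  by apply: ge' => x; rewrite mulN1r normrN.
lra.
Qed.

Section joint_law_TV.
Context {R : realType} {dX dY dU} {X : measurableType dX}
  {Y : measurableType dY} {U : measurableType dU}.
Variables (T T' : R.-pker (X * U)%type ~> X) (Q Q' : R.-pker X ~> Y).
Variables (cT cQ : R).
Hypothesis TT' : forall s (f : X -> R) (M : R), measurable_fun setT f ->
  (forall x, `|f x| <= M) ->
  `|\int[T s]_x f x - \int[T' s]_x f x| <= M * cT.
Hypothesis QQ' : forall s (f : Y -> R) (M : R), measurable_fun setT f ->
  (forall x, `|f x| <= M) ->
  `|\int[Q s]_x f x - \int[Q' s]_x f x| <= M * cQ.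
Variables (z : probability X R) (u : U).

Let TE s : T s setT = 1%E. Proof. exact: prob_kernel. Qed.
Let TE' s : T' s setT = 1%E. Proof. exact: prob_kernel. Qed.
Let QE s : Q s setT = 1%E. Proof. exact: prob_kernel. Qed.
Let QE' s : Q' s setT = 1%E. Proof. exact: prob_kernel. Qed.

Let predictor_TV (f : X -> R) (M : R) : measurable_fun setT f ->
  (forall x, `|f x| <= M) ->
  `|\int[predictor T z u]_x f x - \int[predictor T' z u]_x f x| <= M * cT.
Proof.
move=> mf fM.
rewrite (Rintegral_predictor _ _ _ mf fM) (Rintegral_predictor _ _ _ mf fM).
have zT : z setT = 1%E by exact: probability_setT.
have mI (k : R.-pker (X * U)%type ~> X) :
    measurable_fun setT (fun x0 => \int[k (x0, u)]_x f x).
  apply: (measurable_Rintegral_kernel _ _ mf fM).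
    by move=> s; exact: prob_kernel.
  by move=> A mA; exact: measurableT_comp (measurable_kernel k _ mA) (pair2_measurable _).
have bI (k : R.-pker (X * U)%type ~> X) x0 : `|\int[k (x0, u)]_x f x| <= M.
  by apply: norm_Rintegral_le => //; exact: prob_kernel.
rewrite -RintegralB//; [|exact: bounded_integrable (mI T) (bI T)|
  exact: bounded_integrable (mI T') (bI T')].
apply: norm_Rintegral_le => //; first exact: measurable_funB.
by move=> x; exact: TT'.
Qed.

(** The two kernels are exchanged one at a time, through the joint law built from [T'] and [Q].
    Integrating out the observation first leaves a function of [x] still bounded by [M], to which
    the predictor bound applies. *)
Lemma joint_law_TV (f : X * Y -> R) (M : R) : measurable_fun setT f ->
  (forall p, `|f p| <= M) ->
  `|\int[joint_law T Q z u]_p f p - \int[joint_law T' Q' z u]_p f p|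
    <= M * (cT + cQ).
Proof.
move=> mf fM.
rewrite !(Rintegral_joint_law _ _ _ _ mf fM).
have mfx x : measurable_fun setT (fun y => f (x, y)).
  exact: measurableT_comp mf (pair1_measurable x).
have mI (k : R.-pker X ~> Y) : measurable_fun setT (fun x => \int[k x]_y f (x, y)).
  exact: (measurable_Rintegral_section (h := id) _ _ mf fM).
have bI (k : R.-pker X ~> Y) x : `|\int[k x]_y f (x, y)| <= M.
  by apply: norm_Rintegral_le => //; exact: prob_kernel.
have p'T := predictor_setT T' z u.
have := predictor_TV (mI Q) (bI Q).
set a := (X in X - _); set b := (X in _ - X) => ab.
set c := (X in _ - X).
suff bc : `|b - c| <= M * cQ.
  by rewrite mulrDr (le_trans _ (lerD ab bc))// (le_trans _ (ler_normD _ _))//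
    subrKA.
rewrite /b /c -RintegralB//; [|exact: bounded_integrable (mI Q) (bI Q)|
  exact: bounded_integrable (mI Q') (bI Q')].
apply: norm_Rintegral_le => //; first exact: measurable_funB.
by move=> x; exact: QQ'.
Qed.

Lemma obs_law_TV (f : Y -> R) (M : R) : measurable_fun setT f ->
  (forall y, `|f y| <= M) ->
  `|\int[obs_law T Q z u]_y f y - \int[obs_law T' Q' z u]_y f y|
    <= M * (cT + cQ).
Proof.
move=> mf fM; rewrite !(Rintegral_obs_law _ _ _ _ mf fM).
apply: (joint_law_TV (f := fun p => f p.2)) => //.
exact: measurableT_comp mf measurable_snd.
Qed.

End joint_law_TV.

(** * Countable reductions for bounded Lipschitz functions *)

(** At each level [n] the code splits [S] into countably many classes; [e] enumerates one
    representative per nonempty class. This replaces separability arguments in function and measure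
    spaces: it suffices to find codes such that equal codes imply closeness. *)
Lemma countable_code_net {T : Type} {C : countType} (c : nat -> T -> C)
    (S : set T) : S !=set0 ->
  exists2 e : nat -> T, forall k, S (e k) &
    forall n t, S t -> exists k, c n (e k) = c n t.
Proof.
move=> [t0 St0].
have : forall nc : nat * C, exists t, S t /\
    forall s, S s -> c nc.1 s = nc.2 -> c nc.1 t = nc.2.
  move=> nc; have [[t [St <-]]|no] := pselect (exists t, S t /\ c nc.1 t = nc.2).
    by exists t.
  by exists t0; split => // s Ss sE; exfalso; apply: no; exists s.
move=> /choice[e' e'P].
(* [t0] is a default for the indices that encode no pair, so that [e] stays in [S]. *)
exists (fun k => if unpickle k is Some nc then e' nc else t0) => [k|n t St].
  by case: unpickle => // nc; have [] := e'P nc.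
exists (pickle (n, c n t)); rewrite pickleK.
by have [_ /(_ t St erefl)] := e'P (n, c n t).
Qed.

Lemma floor_eq_dist {R : realType} (x y : R) :
  Num.floor x = Num.floor y -> `|x - y| <= 1.
Proof.
move=> xy.
have := floor_itv x; have := floor_itv y.
by rewrite xy !intrD ler_norml; lra.
Qed.

Section BL_ball_theory.
Context {R : realType} {T : Type}.

(** Both norms are finite, being nonnegative with sum at most 1, and each is attained as a bound:
    [a] is the sup norm and [b] the best Lipschitz constant. *)
Lemma BL_ballP (dist : T -> T -> \bar R) (D : T -> T -> R) (x0 : T) f :
  (forall x y, dist x y = (D x y)%:E) -> (forall x y, 0 <= D x y) ->
  BL_ball dist f -> exists a b : R, [/\ 0 <= a, 0 <= b, a + b <= 1,
    forall x, `|f x| <= a & forall x y, `|f x - f y| <= b * D x y].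
Proof.
move=> DE D0; rewrite /BL_ball/= => f1.
have a0 : (0 <= sup_norm f)%E.
  by apply: (@le_trans _ _ `|f x0|%:E);
    [rewrite lee_fin|apply: ereal_sup_ubound; exists x0].
have b0 : (0 <= lip_const dist f)%E.
  by apply: le_ereal_inf_tmp => _ [L [L0 _] <-]; rewrite lee_fin.
have [a aE] : exists a, sup_norm f = a%:E.
  exists (fine (sup_norm f)); rewrite fineK// ge0_fin_numE//.
  by rewrite (le_lt_trans _ (ltry 1))// (le_trans _ f1)// leeDl.
have [b bE] : exists b, lip_const dist f = b%:E.
  exists (fine (lip_const dist f)); rewrite fineK// ge0_fin_numE//.
  by rewrite (le_lt_trans _ (ltry 1))// (le_trans _ f1)// leeDr.
exists a, b; split.
- by rewrite -lee_fin -aE.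
- by rewrite -lee_fin -bE.
- by rewrite -lee_fin EFinD -aE -bE.
- by apply: sup_norm_leP; rewrite aE.
- move=> x y.
  (* For [D x y > 0] divide by it and take the infimum. For [D x y = 0] any real Lipschitz constant
     forces [f x = f y]; one exists, since otherwise the infimum over the empty set would be
     infinite. *)
  have := D0 x y; rewrite le_eqVlt => /predU1P[D00|Dpos].
    have [L Lf] : exists L : R,
        (forall x y, `|f x - f y|%:E <= L%:E * dist x y)%E.
      apply: contrapT => noL.
      have : lip_const dist f = +oo%E; last by rewrite bE.
      rewrite /lip_const (_ : [set _ | _ in _] = set0) ?ereal_inf0//.
      by apply/seteqP; split => // e [L [_ Lf] _]; apply: noL; exists L.
    by have := Lf x y; rewrite DE -D00 mule0 mulr0 lee_fin.
  rewrite -ler_pdivrMr// -lee_fin -bE.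
  apply: le_ereal_inf_tmp => _ [L [L0 Lf] <-].
  by rewrite lee_fin ler_pdivrMr// -lee_fin EFinM -DE.
Qed.

Lemma BL_ball_cst0 (dist : T -> T -> \bar R) :
  (forall x y, 0 <= dist x y)%E -> BL_ball dist (cst 0).
Proof.
move=> d0; rewrite /BL_ball/=.
have -> : 1%E = (1 + 0 :> \bar R)%E by rewrite adde0.
apply: leeD.
  by apply: ge_ereal_sup => _ [x _ <-]; rewrite normr0 lee_fin.
apply: ereal_inf_lbound; exists 0 => //; split => // x y.
by rewrite subrr normr0 mul0e.
Qed.

End BL_ball_theory.

Lemma continuous_borel_measurable {R : realType} (X : ptopologicalType)
    (f : X -> R) : continuous f -> measurable_fun setT (f : borel X -> R).
Proof.
move=> cf; apply: (measurability _ (RGenOInfty.measurableE R)).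
move=> _ [_ [a ->] <-]; rewrite setTI; apply: sub_sigma_algebra.
by apply: open_comp; [move=> x _; exact: cf|exact: interval_open].
Qed.

Section BL_functions.
Context {R : realType} {X : completeMetricType R}.
Notation BL := (BL_ball (@Defs.edist R X)).

Lemma BL_edistP (f : X -> R) : BL f ->
  (forall x, `|f x| <= 1) /\ (forall x y, `|f x - f y| <= mdist x y).
Proof.
move=> BLf.
have [a [b [a0 b0 ab fa fb]]] :=
  BL_ballP point (fun x y => erefl) (@mdist_ge0 _ _) BLf.
split => [x|x y].
  by apply: le_trans (fa x) _; lra.
apply: le_trans (fb x y) _; rewrite ler_piMl ?mdist_ge0//; lra.
Qed.

Lemma BL_continuous (f : X -> R) : BL f -> continuous f.
Proof.
move=> /BL_edistP[_ fL] x; apply/cvgrPdist_lt => e e0.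
near=> y; apply: (le_lt_trans (fL x y)).
near: y; apply/nbhs_ballP; exists e => // y.
by rewrite ballEmdist.
Unshelve. all: by end_near. Qed.

Lemma BL_measurable (f : X -> R) : BL f ->
  measurable_fun setT (f : borel X -> R).
Proof. by move=> /BL_continuous; exact: continuous_borel_measurable. Qed.

Lemma open_mdist_ball (x : X) (e : R) : open [set y | mdist x y < e].
Proof.
rewrite openE => y /= xy; apply/nbhs_ballP; exists (e - mdist x y).
  by rewrite /= subr_gt0.
move=> w; rewrite ballEmdist/= ltrBrDl; apply: le_lt_trans.
exact: metric_triangle.
Qed.

Lemma separable_dense_sequence : separable X ->
  exists d : nat -> X, forall x (e : R), 0 < e -> exists i, mdist (d i) x < e.
Proof.
move=> [D cD dD].
have ne x (e : R) : 0 < e -> exists2 y, D y & mdist y x < e.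
  move=> e0; have [|y [xy Dy]] := dD [set y | mdist x y < e] _ (open_mdist_ball x e).
    by exists x => /=; rewrite mdistxx.
  by exists y => //; rewrite metric_sym.
have D0 : D !=set0 by have [y Dy _] := ne point 1 ltr01; exists y.
have /countable_injP[c cinj] := cD.
(* The code is injective on [D], so every class is a single point and the net enumerates [D]. *)
have [d dD' dc] := countable_code_net (fun _ : nat => c) D0.
exists d => x e /(ne x)[y Dy yx].
have [i ci] := dc 0%N y Dy; exists i.
by rewrite (cinj (d i) y) ?inE.
Qed.

End BL_functions.

Section countable_reductions.
Context {R : realType} {X : completeMetricType R}.
Notation BL := (BL_ball (@Defs.edist R X)).
Implicit Types mu nu : prob_space X.

Lemma prob_measureT mu : prob_measure mu setT = 1%E.
Proof. exact: probability_setT. Qed.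

(** A function in the ball is bounded and continuous, so its integral is one of the coordinates that
    the weak topology makes continuous. *)
Lemma measurable_prob_Rintegral (f : X -> R) : BL f ->
  measurable_fun setT (fun mu : prob_space X => \int[prob_measure mu]_x f x).
Proof.
move=> BLf.
have bf : continuous f /\ bounded_fun f.
  split; first exact: BL_continuous.
  have [f1 _] := BL_edistP BLf.
  exists 1; split; first exact: num_real.
  by move=> M M1 x _ /=; rewrite (le_trans (f1 x))// ltW.
apply: (@continuous_borel_measurable _ (prob_weak X)).
move=> mu.
apply: (@continuous_comp (prob_weak X) _ _ (@weak_eval R X)
  (@proj _ (fun=> R : topologicalType) (exist _ f bf))).
- exact: initial_continuous.
- exact: (@proj_continuous {classic (bounded_continuous X)} (fun=> R)).
Qed.

(** The code of level [n] records [f] at the first [n] points of a dense sequence with precision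
    [1/(n+1)]. Functions sharing it are close at those points, and the common Lipschitz bound
    carries this to every [x]. *)
Lemma BL_sequence : separable X ->
  exists2 g : nat -> X -> R, forall k, BL (g k) &
    forall f, BL f -> exists s : nat -> nat, forall x, g (s n) x @[n --> \oo] --> f x.
Proof.
move=> /separable_dense_sequence[d dd].
pose c n (f : X -> R) : seq int := [seq Num.floor (f (d i) * n.+1%:R) | i <- iota 0 n].
have BL0 : BL !=set0.
  exists (cst 0); apply: BL_ball_cst0 => x y.
  by rewrite lee_fin mdist_ge0.
have [g BLg gc] := countable_code_net c BL0; exists g => // f BLf.
have /choice[s sE] : forall n, exists k, c n (g k) = c n f by move=> n; exact: gc.
exists s => x.
suff H (e : R) : 0 < e -> \forall n \near \oo, `|f x - g (s n) x| <= e.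
  by apply/cvgrPdist_le.
move=> e0.
(* Three errors: moving from [x] to [d i] under [f] and under [g (s n)], and the rounding at
   [d i]. *)
have [i di] := dd x (e / 3) (divr_gt0 e0 (ltr0n _ 3)).
have [_ fL] := BL_edistP BLf.
near=> n.
have [_ gL] := BL_edistP (BLg (s n)).
have n0 : 0 < n.+1%:R :> R by [].
have i_n : (i < n)%N by near: n; exists i.+1.
have : nth 0 (c n (g (s n))) i = nth 0 (c n f) i by rewrite sE.
rewrite !(nth_map 0%N) ?size_iota// nth_iota// add0n => /floor_eq_dist.
rewrite -mulrBl normrM (ger0_norm (ltW n0)) -ler_pdivlMr// mul1r => gf.
have ne : n.+1%:R^-1 < e / 3.
  by near: n; exact: (near_infty_natSinv_lt (PosNum (divr_gt0 e0 (ltr0n _ 3)))).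
have := gL (d i) x; have := fL (d i) x.
move: (n.+1%:R^-1) gf ne di => w; rewrite !ler_norml; lra.
Unshelve. all: by end_near. Qed.

(** Pointwise approximation together with the common bound 1 gives convergence of the integrals, by
    dominated convergence. *)
Lemma BL_countable : separable X ->
  exists2 g : nat -> X -> R, forall k, BL (g k) &
    forall f, BL f -> forall mu nu (e : R), 0 < e -> exists k,
      \int[prob_measure mu]_x f x - \int[prob_measure nu]_x f x <=
      \int[prob_measure mu]_x g k x - \int[prob_measure nu]_x g k x + e.
Proof.
move=> /BL_sequence[g BLg gP]; exists g => // f BLf mu nu e e0.
have [s gf] := gP f BLf.
have [f1 _] := BL_edistP BLf.
have cvgI m : \int[prob_measure m]_x g (s n) x @[n --> \oo] -->
    \int[prob_measure m]_x f x.
  have [] := @dominated_convergence _ _ _ (prob_measure m) setT measurableT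
    (fun n x => (g (s n) x)%:E) (EFin \o f) (cst 1%E).
  - by move=> n; apply/measurable_EFinP; exact: BL_measurable.
  - by apply/measurable_EFinP; exact: BL_measurable.
  - by apply: aeW => x _; apply/cvg_EFin; [exact: nearW|exact: gf].
  - apply: (@bounded_integrable _ _ _ _ _ (cst 1) 1) => //.
      exact: prob_measureT.
    by move=> x; rewrite normr1.
  - apply: aeW => x n _; rewrite lee_fin.
    by have [g1 _] := BL_edistP (BLg (s n)).
  move=> _ _; rewrite [X in _ --> X](_ : _ = (\int[prob_measure m]_x f x)%:E).
    by move/fine_cvgP => [].
  by rewrite -(integral_EFin_bounded (prob_measureT m) (BL_measurable BLf) f1).
have : \forall n \near \oo,
    `|(\int[prob_measure mu]_x f x - \int[prob_measure nu]_x f x) -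
      (\int[prob_measure mu]_x g (s n) x - \int[prob_measure nu]_x g (s n) x)| <= e.
  by move: e e0; apply/cvgrPdist_le; apply: cvgB.
move=> [n _ /(_ n)/= nP]; exists (s n).
have := nP (leqnn n); rewrite ler_norml => *; lra.
Qed.

End countable_reductions.

(** * Comparison of integrals over a countable partition *)

Section simple_comparison.
Context {R : realType} {d} {T : measurableType d}.
Variable A : nat -> set T.
Hypothesis mA : forall i, measurable (A i).
Implicit Types (c : nat -> R) (m : {measure set T -> \bar R}).

Let simple c N x : R := \sum_(i < N) c i * \1_(A i) x.

Let measurable_simple c N : measurable_fun setT (simple c N).
Proof.
by apply: measurable_sum => i; exact: measurable_funM.
Qed.

Let simple_bounded c N x : `|simple c N x| <= \sum_(i < N) `|c i|.
Proof.
apply: (le_trans (ler_norm_sum _ _ _)); apply: ler_sum => i _.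
by rewrite normrM indicE; case: (_ \in _); rewrite ?normr1 ?mulr1// normr0 mulr0.
Qed.

Lemma Rintegral_simple m c N : m setT = 1%E ->
  \int[m]_x simple c N x = \sum_(i < N) c i * fine (m (A i)).
Proof.
move=> mT; elim: N => [|N IH].
  by rewrite big_ord0 (@eq_Rintegral _ _ _ m setT (cst 0)) ?Rintegral_cst ?mul0r// => x _;
    rewrite /simple big_ord0.
have mI : m.-integrable setT (EFin \o \1_(A N)).
  apply: (@bounded_integrable _ _ _ _ _ \1_(A N) 1) => //.
  by move=> x; rewrite indicE; case: (_ \in _); rewrite ?normr1// normr0.
have mc : measurable_fun setT (fun x => c N * \1_(A N) x : R).
  exact: measurable_funM.
rewrite (@eq_Rintegral _ _ _ m setT
  (fun x => simple c N x + c N * \1_(A N) x)); last first.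
  by move=> x _; rewrite /simple big_ord_recr.
rewrite RintegralD//; last 2 first.
- exact: bounded_integrable (simple_bounded c N).
- apply: (@bounded_integrable _ _ _ _ _ _ `|c N|) => // x.
  by rewrite normrM indicE; case: (_ \in _); rewrite ?normr1 ?mulr1// normr0 mulr0.
rewrite IH RintegralZl// big_ord_recr/=; congr (_ + _ * _).
by rewrite /Rintegral integral_indic// setIT.
Qed.

(** Replacing [f] by [c i] on each cell costs [e] per measure, the mass outside the first [N] cells
    counts with weight one since [|f| <= 1], and the last sum compares the masses of the cells. *)
Lemma Rintegral_cells_close m m' (f : T -> R) c (e : R) N :
  m setT = 1%E -> m' setT = 1%E -> trivIset setT A ->
  measurable_fun setT f -> (forall x, `|f x| <= 1) ->
  (forall i, `|c i| <= 1) -> (forall i x, A i x -> `|f x - c i| <= e) -> 0 <= e ->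
  \int[m]_x f x - \int[m']_x f x <=
    2 * e + (1 - \sum_(i < N) fine (m (A i))) + (1 - \sum_(i < N) fine (m' (A i)))
    + \sum_(i < N) `|fine (m (A i)) - fine (m' (A i))|.
Proof.
move=> mT m'T tA mf f1 c1 fc e0.
have simpleE b x : (exists2 j : 'I_N, A j x & simple b N x = b j) \/
    ((forall b', simple b' N x = 0)).
  have [[j Aj]|nA] := pselect (exists j : 'I_N, A j x).
    left; exists j => //; rewrite /simple (bigD1 j)//= indicE mem_set// mulr1.
    rewrite big1 ?addr0// => i ij; rewrite indicE memNset ?mulr0// => Ai.
    move/negP: ij; apply; apply/eqP/val_inj.
    by apply: tA => //; exists x.
  right => b'; rewrite /simple big1// => i _.
  by rewrite indicE memNset ?mulr0// => Ai; apply: nA; exists i.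
have fi (n : {measure set T -> \bar R}) : n setT = 1%E -> n.-integrable setT (EFin \o f).
  by move=> nT; exact: (bounded_integrable nT mf f1).
have si (n : {measure set T -> \bar R}) b r : n setT = 1%E ->
    n.-integrable setT (EFin \o (fun x => simple b N x + r)).
  move=> nT; apply: (@bounded_integrable _ _ _ _ nT _ (\sum_(i < N) `|b i| + `|r|)).
    exact: measurable_funD.
  by move=> x; rewrite (le_trans (ler_normD _ _))// lerD2r simple_bounded.
have Is (n : {measure set T -> \bar R}) b r : n setT = 1%E ->
    \int[n]_x (simple b N x + r) =
    \sum_(i < N) b i * fine (n (A i)) + r.
  move=> nT; rewrite RintegralD//; last 2 first.
  - exact: bounded_integrable (simple_bounded b N).
  - by apply: (@bounded_integrable _ _ _ _ _ _ `|r|).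
  by rewrite Rintegral_cst// nT mulr1 Rintegral_simple.
(* (c_i + 1) - (1 + e) <= f <= (c_i - 1) + (1 + e) on A_i, and both bounds are
   valid off the cells because |f| <= 1. *)
have up : \int[m]_x f x <= \sum_(i < N) (c i - 1) * fine (m (A i)) + (e + 1).
  rewrite -(Is m (fun i => c i - 1))//; apply: le_Rintegral => //;
    [exact: fi|exact: si|move=> x _].
  have [[j Aj ->]|->] := simpleE (fun i => c i - 1) x.
    by have := fc j x Aj; rewrite ler_norml; lra.
  by have := f1 x; rewrite ler_norml; lra.
have dn : \sum_(i < N) (c i + 1) * fine (m' (A i)) + (- (e + 1)) <= \int[m']_x f x.
  rewrite -(Is m' (fun i => c i + 1))//; apply: le_Rintegral => //;
    [exact: si|exact: fi|move=> x _].
  have [[j Aj ->]|->] := simpleE (fun i => c i + 1) x.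
    by have := fc j x Aj; rewrite ler_norml; lra.
  by have := f1 x; rewrite ler_norml; lra.
have : \sum_(i < N) (c i - 1) * fine (m (A i)) -
    \sum_(i < N) (c i + 1) * fine (m' (A i)) <=
    \sum_(i < N) (`|fine (m (A i)) - fine (m' (A i))| - fine (m (A i)) - fine (m' (A i))).
  rewrite -sumrB; apply: ler_sum => i _.
  have : c i * (fine (m (A i)) - fine (m' (A i))) <=
      `|fine (m (A i)) - fine (m' (A i))|.
    apply: (le_trans (ler_norm _)); rewrite normrM ler_piMl//.
  by lra.
rewrite !sumrB; lra.
Qed.

End simple_comparison.

(** * A countable dense family of probability measures *)

Section dense_measures.
Context {R : realType} {X : completeMetricType R}.
Notation BL := (BL_ball (@Defs.edist R X)).

(** Cut [X] into disjoint cells of radius [1/(n+1)] around dense points. The code of a measure lists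
    its rounded masses on finitely many cells carrying all but [1/(n+1)] of it, and equal codes make
    the cell comparison effective uniformly over the ball. *)
Lemma BL_dense_measures : separable X ->
  exists nu : nat -> prob_space X, forall mu (e : R), 0 < e -> exists k,
    forall f, BL f -> `|\int[prob_measure mu]_x f x -
      \int[prob_measure (nu k)]_x f x| <= e.
Proof.
move=> /separable_dense_sequence[d dd].
pose A n : nat -> set (borel X) :=
  seqDU (fun i => [set y : X | mdist (d i) y < n.+1%:R^-1]).
have mA n i : measurable (A n i).
  apply: measurableD; first by apply: sub_sigma_algebra; exact: open_mdist_ball.
  by apply: bigsetU_measurable => j _; apply: sub_sigma_algebra; exact: open_mdist_ball.
have tA n : trivIset setT (A n) by exact: trivIset_seqDU.
have AT n : \bigcup_i A n i = setT.
  rewrite -seqDU_bigcup_eq; apply/seteqP; split => // x _.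
  by have [|i di] := dd x n.+1%:R^-1; [by rewrite invr_gt0|exists i].
have Nex n (mu : prob_space X) : exists N,
    1 - n.+1%:R^-1 <= \sum_(i < N) fine (prob_measure mu (A n i)).
  have : ((fun N => \sum_(0 <= i < N) prob_measure mu (A n i))%E @ \oo -->
      prob_measure mu setT).
    by rewrite -(AT n); apply: measure_semi_sigma_additive => //; rewrite AT.
  rewrite prob_measureT => /fine_cvgP[_] /cvgrPdist_le /(_ n.+1%:R^-1).
  move=> [|N _ /(_ N (leqnn N))/=]; first by rewrite invr_gt0.
  rewrite -sum_fine; last by move=> i _; exact: fin_num_measure.
  by rewrite big_mkord => NP; exists N; move: (n.+1%:R^-1) NP => w; rewrite ler_norml; lra.
have /choice[N NP] : forall nmu : nat * prob_space X, exists N,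
    1 - nmu.1.+1%:R^-1 <= \sum_(i < N) fine (prob_measure nmu.2 (A nmu.1 i)).
  by move=> [n mu]; exact: Nex.
(* The precision [1/((N+1)(n+1))] keeps the sum of [N] rounding errors below [1/(n+1)]. *)
pose c n (mu : prob_space X) : seq int :=
  [seq Num.floor (fine (prob_measure mu (A n i)) * ((N (n, mu)).+1%:R * n.+1%:R))
    | i <- iota 0 (N (n, mu))].
have [nu _ nuc] := countable_code_net c (S := setT) (ex_intro _ point I).
exists nu => mu e e0.
(* The cell comparison yields five errors of size [1/(n+1)]: two from oscillation in the cells, two
   from missing mass, one from rounding. *)
have [n ne] : exists n, n.+1%:R^-1 < e / 5.
  have [n _ /(_ n)nP] := near_infty_natSinv_lt (PosNum (divr_gt0 e0 (ltr0n _ 5))).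
  by exists n; exact: (nP (leqnn n)).
have [k ck] := nuc n mu I; exists k => f BLf.
(* The length of the code reveals the number of cells, so both measures use the same ones. *)
have Neq : N (n, nu k) = N (n, mu).
  by have := congr1 size ck; rewrite !size_map !size_iota.
have [f1 fL] := BL_edistP BLf.
have dist_le : \sum_(i < N (n, mu)) `|fine (prob_measure mu (A n i)) -
    fine (prob_measure (nu k) (A n i))| <= n.+1%:R^-1.
  pose K : R := (N (n, mu)).+1%:R * n.+1%:R.
  have K0 : 0 < K by rewrite mulr_gt0.
  apply: (@le_trans _ _ (\sum_(i < N (n, mu)) K^-1)).
    apply: ler_sum => i _.
    have : nth 0 (c n mu) i = nth 0 (c n (nu k)) i by rewrite ck.
    rewrite !(nth_map 0%N) ?size_iota ?Neq// nth_iota// add0n => /floor_eq_dist.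
    by rewrite -mulrBl normrM (ger0_norm (ltW K0)) -ler_pdivlMr// mul1r.
  rewrite sumr_const card_ord -[leLHS]mulr_natl /K invfM mulrA ler_piMl//.
  by rewrite ler_pdivrMr// mul1r ler_nat.
have fd i x : A n i x -> `|f x - f (d i)| <= n.+1%:R^-1.
  move=> [xi _]; rewrite distrC (le_trans (fL _ _))// ltW//.
have := NP (n, mu); have := NP (n, nu k); rewrite /= Neq => N1 N2.
have n0 : 0 <= n.+1%:R^-1 :> R by [].
have mf := BL_measurable BLf.
have H1 := Rintegral_cells_close (mA n) (N (n, mu)) (prob_measureT mu)
  (prob_measureT (nu k)) (tA n) mf f1 (fun i => f1 (d i)) fd n0.
have H2 := Rintegral_cells_close (mA n) (N (n, mu)) (prob_measureT (nu k))
  (prob_measureT mu) (tA n) mf f1 (fun i => f1 (d i)) fd n0.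
move: H2; under [X in _ <= _ + X]eq_bigr do rewrite distrC.
move: (n.+1%:R^-1) ne dist_le N1 N2 H1 => w.
rewrite ler_norml; lra.
Qed.

End dense_measures.

(** * The distance rho_BL *)

Section rho_BL_theory.
Context {R : realType} {X : completeMetricType R}.
Notation BL := (BL_ball (@Defs.edist R X)).
Notation "''I' ( f , mu )" := (\int[prob_measure mu]_x f x).
Implicit Types mu nu : prob_space X.

Lemma rho_BLP mu nu : exists2 r : R, rho_BL mu nu = r%:E & 0 <= r /\
  forall e : R, 0 < e -> exists2 h, BL h & r <= 'I(h, mu) - 'I(h, nu) + e.
Proof.
have IE h m : BL h ->
    (\int[prob_measure m]_x (h x)%:E = ('I(h, m))%:E)%E /\ `|'I(h, m)| <= 1.
  move=> BLh; have [h1 _] := BL_edistP BLh; have mh := BL_measurable BLh.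
  split; first exact: (integral_EFin_bounded (prob_measureT m) mh h1).
  exact: (norm_Rintegral_le (prob_measureT m) mh h1).
have BL0 : BL (cst 0) by apply: BL_ball_cst0 => x y; rewrite lee_fin mdist_ge0.
have ge0 : (0 <= rho_BL mu nu)%E.
  apply: ereal_sup_ubound; exists (cst 0) => //.
  by rewrite !integral0 sube0.
have le2 : (rho_BL mu nu <= 2%:E)%E.
  apply: ge_ereal_sup => _ [h BLh <-].
  have [-> hm] := IE h mu BLh; have [-> hn] := IE h nu BLh.
  by move: hm hn; rewrite -EFinB lee_fin !ler_norml; lra.
have fin : rho_BL mu nu \is a fin_num.
  by rewrite ge0_fin_numE// (le_lt_trans le2)// ltry.
have [r rE] : exists r, rho_BL mu nu = r%:E
  by exists (fine (rho_BL mu nu)); rewrite fineK.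
exists r => //; split; first by rewrite -lee_fin -rE.
move=> e e0; have [_ [h BLh <-]] := ub_ereal_sup_adherent e0 fin.
have [-> _] := IE h mu BLh; have [-> _] := IE h nu BLh.
rewrite -/(rho_BL mu nu) rE -!EFinB lte_fin => rh; exists h => //; lra.
Qed.

Definition BL_norming (g : nat -> X -> R) : Prop :=
  (forall k, BL (g k)) /\
  forall f, BL f -> forall mu nu (e : R), 0 < e -> exists k,
    'I(f, mu) - 'I(f, nu) <= 'I(g k, mu) - 'I(g k, nu) + e.

(** The Lipschitz bound in [rho_BL] is made countable: a near-optimal test function loses [e / 2],
    its replacement by some [g k] another [e / 2], and the factor [b <= 1] does not enlarge the
    loss. *)
Lemma BL_prob_spaceP (g : nat -> X -> R) (f : prob_space X -> R) :
  BL_norming g -> BL_ball (@rho_BL R X) f ->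
  exists a b : R, [/\ 0 <= a, 0 <= b, a + b <= 1, forall mu, `|f mu| <= a &
    forall mu nu (e : R), 0 < e -> exists k,
      `|f mu - f nu| <= b * ('I(g k, mu) - 'I(g k, nu)) + e].
Proof.
move=> [BLg gP] BLf.
have rhoE mu nu : rho_BL mu nu = (fine (rho_BL mu nu))%:E.
  by have [r -> _] := rho_BLP mu nu.
have rho0 mu nu : 0 <= fine (rho_BL mu nu).
  by have [r -> []] := rho_BLP mu nu.
have [a [b [a0 b0 ab fa fb]]] := BL_ballP (point : prob_space X) rhoE rho0 BLf.
exists a, b; split => // mu nu e e0.
have [r rE [r0 rP]] := rho_BLP mu nu.
have e20 : 0 < e / 2 by rewrite divr_gt0.
have [h BLh rh] := rP _ e20.
have [k hk] := gP _ BLh mu nu _ e20; exists k.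
have := fb mu nu; rewrite rE/= => /le_trans; apply.
apply: (@le_trans _ _ (b * ('I(g k, mu) - 'I(g k, nu) + e))).
  rewrite ler_wpM2l//; lra.
by rewrite mulrDr lerD2l ler_piMl ?(ltW e0)//; lra.
Qed.

(* McShane: f is the infimum over k of f (nu_ k) + b rho_BL (., nu_ k) for a
   dense sequence nu_, and rho_BL is a supremum over the norming sequence. *)
Lemma BL_comp_measurable d (S : measurableType d) (Phi : S -> prob_space X)
    (f : prob_space X -> R) : separable X ->
  (forall h, BL h -> measurable_fun setT (fun s => 'I(h, Phi s))) ->
  BL_ball (@rho_BL R X) f -> measurable_fun setT (f \o Phi).
Proof.
move=> sX mPhi BLf.
have [g BLg gP] := BL_countable sX.
have [nu nuP] := BL_dense_measures sX.
have [a [b [a0 b0 ab fa fb]]] := BL_prob_spaceP (conj BLg gP) BLf.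
pose H k j s : R := f (nu k) + b * ('I(g j, Phi s) - 'I(g j, nu k)).
have mH k j : measurable_fun setT (H k j).
  by apply: measurable_funD => //; apply: measurable_funM => //;
    apply: measurable_funB => //; exact: mPhi.
apply: (measurability _ (RGenInftyO.measurableE R)).
move=> _ [_ [r ->] <-]; rewrite setTI.
(* The infimum is below [r] when some [k] gives a value below [r]; the margin [1/(n+1)] keeps the
   inequality strict through the supremum over [j]. *)
rewrite (_ : _ @^-1` _ = \bigcup_k \bigcup_n \bigcap_j
    (H k j @^-1` `]-oo, r - n.+1%:R^-1])); last first.
  apply/seteqP; split => s /=; rewrite in_itv/=.
    (* With [w = 1/(n+1)], going from [f (Phi s)] to [f (nu k)] costs [2 w], the term with [g j]
       costs [w], and a last [w] is the required margin. *)
    move=> fr; have e0 : 0 < (r - f (Phi s)) / 4 by rewrite divr_gt0// subr_gt0.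
    have [n _ /(_ _ (leqnn n))/= nr] := near_infty_natSinv_lt (PosNum e0).
    have w0 : 0 < n.+1%:R^-1 :> R by rewrite invr_gt0.
    have [k kP] := nuP (Phi s) _ w0.
    exists k => //; exists n => // j _ /=; rewrite in_itv/= /H.
    move: (n.+1%:R^-1) nr w0 kP => w nr w0 kP.
    have bI i : b * ('I(g i, Phi s) - 'I(g i, nu k)) <= w.
      have wb : b * w <= w by rewrite ler_piMl ?(ltW w0)//; lra.
      apply: le_trans wb; rewrite ler_wpM2l// (le_trans (ler_norm _))//.
      exact: kP.
    have [i fi] := fb (Phi s) (nu k) w w0.
    by have := bI i; have := bI j; move: fi; rewrite ler_norml; lra.
  move=> [k _ [n _ ins]].
  have w0 : 0 < n.+1%:R^-1 / 2 :> R by rewrite divr_gt0// invr_gt0.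
  have [j fj] := fb (Phi s) (nu k) _ w0.
  have := ins j I; rewrite /= in_itv/= /H.
  by move: (n.+1%:R^-1) w0 fj => w w0; rewrite ler_norml; lra.
apply: bigcup_measurable => k _; apply: bigcup_measurable => n _.
apply: bigcap_measurable => // j _.
by rewrite -[X in measurable X]setTI; apply: mH => //; exact: measurable_itv.
Qed.

End rho_BL_theory.

(** * Measurable selection among countably many test functions *)

Lemma measurable_first_index d (Y : measurableType d) (B : nat -> set Y) :
  (forall k, measurable (B k)) -> \bigcup_k B k = setT ->
  exists2 kk : Y -> nat, forall y, B (kk y) y &
    forall k, measurable (kk @^-1` [set k]).
Proof.
move=> mB BT.
have tB := trivIset_seqDU B.
have /choice[kk kkP] : forall y, exists k, seqDU B k y.
  move=> y; have : (\bigcup_k seqDU B k) y by rewrite -seqDU_bigcup_eq BT.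
  by move=> [k _ ky]; exists k.
exists kk => [y|k]; first by have [] := kkP y.
(* [seqDU B k] consists of the points whose first index is [k]; these sets are disjoint, so they are
   exactly the fibres of [kk]. *)
rewrite (_ : _ @^-1` _ = seqDU B k).
  by apply: measurableD => //; exact: bigsetU_measurable.
apply/seteqP; split => [y <- //|y ky].
by apply: tB => //; exists y.
Qed.

Lemma measurable_countable_selection {R : realType} {dX dY}
    {X : measurableType dX} {Y : measurableType dY} (g : nat -> X -> R)
    (kk : Y -> nat) : (forall k, measurable_fun setT (g k)) ->
  (forall k, measurable (kk @^-1` [set k])) ->
  measurable_fun setT (fun p : X * Y => g (kk p.2) p.1).
Proof.
move=> mg mkk _ B mB; rewrite setTI.
rewrite (_ : _ @^-1` _ = \bigcup_k ((g k @^-1` B) `*` (kk @^-1` [set k]))).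
  apply: bigcup_measurable => k _; apply: measurableX => //.
  by rewrite -[X in measurable X]setTI; exact: mg.
apply/seteqP; split => [[x y]/= gB|[x y]/= [k _ [/= gB ->//]]].
by exists (kk y).
Qed.


(** * Versions of the conditional law and integrals against the filter kernel *)

Section kernel_of_versions.
Context {R : realType} {X : completeMetricType R} {d} {Y : measurableType d}.
Variable F : Y -> prob_space X.
Hypothesis mF : forall A, measurable A ->
  measurable_fun setT (fun y => prob_measure (F y) A).

Let K (y : Y) : {measure set (borel X) -> \bar R} := prob_measure (F y).

HB.instance Definition _ := isKernel.Build _ _ _ _ R K mF.

HB.instance Definition _ := Kernel_isProbability.Build _ _ _ _ R K
  (fun y => prob_measureT (F y)).

(** Packages a version of the conditional law so that the disintegration and mixture lemmas apply to
    it. *)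
Lemma kernel_of_versions : exists K : R.-pker Y ~> borel X,
  forall y, K y = prob_measure (F y) :> {measure set (borel X) -> \bar R}.
Proof. by exists [the R.-pker Y ~> borel X of K]. Qed.

End kernel_of_versions.

Section filter_kernel_integral.
Context {R : realType} {X : completeMetricType R}.
Context {dY} {Y : measurableType dY} {dU} {U : measurableType dU}.
Variables (T : R.-pker (borel X * U)%type ~> borel X) (Q : R.-pker borel X ~> Y).
Variables (z : prob_space X) (u : U) (F : Y -> prob_space X).
Variable m : {measure set (prob_space X) -> \bar R}.
Hypothesis mE : forall A, measurable A ->
  (m A = \int[obs_law T Q (prob_measure z) u]_y (\1_A (F y))%:E)%E.
Hypothesis mT : m setT = 1%E.

Lemma Rintegral_filter_kernel (f : prob_space X -> R) (M : R) :
  measurable_fun setT f -> measurable_fun setT (f \o F) ->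
  (forall mu, `|f mu| <= M) ->
  \int[m]_mu f mu = \int[obs_law T Q (prob_measure z) u]_y f (F y).
Proof.
move=> mf mfF fM; rewrite /Rintegral; congr fine.
have oT := obs_law_setT T Q (prob_measure z) u.
have mEFin : measurable_fun setT (@EFin R) by exact/measurable_EFinP.
have e1 := @integral_pushforward _ _ _ _ _ _ mf m setT EFin mEFin.
have e2 := @integral_pushforward _ _ _ _ _ _ mfF
  (obs_law T Q (prob_measure z) u) setT EFin mEFin.
rewrite !preimage_setT in e1 e2.
transitivity (\int[pushforward m f]_r r%:E)%E.
  by rewrite e1//; exact: (bounded_integrable mT mf fM).
transitivity (\int[pushforward (obs_law T Q (prob_measure z) u) (f \o F)]_r r%:E)%E;
  last by rewrite e2//; exact: (bounded_integrable oT mfF (fun y => fM (F y))).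
apply: eq_measure_integral => B mB _; rewrite /pushforward.
have mfB : measurable (f @^-1` B) by rewrite -[X in measurable X]setTI; exact: mf.
have mfFB : measurable ((f \o F) @^-1` B).
  by rewrite -[X in measurable X]setTI; exact: mfF.
transitivity (\int[obs_law T Q (prob_measure z) u]_y
  (\1_((f \o F) @^-1` B) y)%:E)%E; first exact: mE.
by rewrite integral_indic// setIT.
Qed.

End filter_kernel_integral.

(** * Comparison of filters *)

Section filter_comparison.
Context {R : realType} {X : completeMetricType R}.
Context {dY} {Y : measurableType dY} {dU} {U : measurableType dU}.
Variables (T T' : R.-pker (borel X * U)%type ~> borel X).
Variables (Q Q' : R.-pker borel X ~> Y).
Variables (cT cQ : R).
Hypothesis TT' : forall s (f : borel X -> R) (M : R), measurable_fun setT f ->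
  (forall x, `|f x| <= M) ->
  `|\int[T s]_x f x - \int[T' s]_x f x| <= M * cT.
Hypothesis QQ' : forall s (f : Y -> R) (M : R), measurable_fun setT f ->
  (forall x, `|f x| <= M) ->
  `|\int[Q s]_x f x - \int[Q' s]_x f x| <= M * cQ.
Hypotheses (cT0 : 0 <= cT) (cQ0 : 0 <= cQ).
Hypothesis sepX : separable X.
Variables (z : prob_space X) (u : U) (F F' : Y -> prob_space X).
Hypothesis rF : regular_conditional T Q z u F.
Hypothesis rF' : regular_conditional T' Q' z u F'.

Let P : {measure set _ -> \bar R} := joint_law T Q (prob_measure z) u.
Let P' : {measure set _ -> \bar R} := joint_law T' Q' (prob_measure z) u.
Let mu : {measure set _ -> \bar R} := obs_law T Q (prob_measure z) u.
Let mu' : {measure set _ -> \bar R} := obs_law T' Q' (prob_measure z) u.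

(** Integrals of test functions against [G y] are measurable in [y] by the kernel property, which is
    what the McShane argument asks of [G]. *)
Lemma measurable_BL_version (T0 : R.-pker (borel X * U)%type ~> borel X)
    (Q0 : R.-pker borel X ~> Y) (G : Y -> prob_space X) (f : prob_space X -> R) :
  regular_conditional T0 Q0 z u G -> BL_ball (@rho_BL R X) f ->
  measurable_fun setT (f \o G).
Proof.
move=> [mG _]; apply: BL_comp_measurable => // h BLh.
have [h1 _] := BL_edistP BLh.
apply: (measurable_Rintegral_kernel _ mG (BL_measurable BLh) h1) => y.
exact: prob_measureT.
Qed.

(* Passing from mu' to mu, and from P to P', each costs cT + cQ. *)
Lemma Rintegral_version_diff (phi : borel X * Y -> R) : measurable_fun setT phi ->
  (forall p, `|phi p| <= 1) ->
  \int[mu']_y (\int[prob_measure (F y)]_x phi (x, y)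
             - \int[prob_measure (F' y)]_x phi (x, y)) <= 2 * (cT + cQ).
Proof.
move=> mphi phi1.
have [mF FE] := rF; have [mF' FE'] := rF'.
have [K KE] := kernel_of_versions mF; have [K' KE'] := kernel_of_versions mF'.
have mphi' : measurable_fun setT (fun p : Y * borel X => phi (p.2, p.1)).
  apply: (measurableT_comp mphi); exact: measurable_fun_pair.
have mI (k : R.-pker Y ~> borel X) :
    measurable_fun setT (fun y => \int[k y]_x phi (x, y)).
  exact: (measurable_Rintegral_section (h := id) k _ mphi' (fun p => phi1 _)).
have bI (k : R.-pker Y ~> borel X) y : `|\int[k y]_x phi (x, y)| <= 1.
  apply: norm_Rintegral_le; [exact: prob_kernel| |by move=> x].
  exact: measurableT_comp mphi (pair2_measurable y).
have mu'T : mu' setT = 1%E by exact: obs_law_setT.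
rewrite (@eq_Rintegral _ _ _ mu' setT
  (fun y => \int[K y]_x phi (x, y) - \int[K' y]_x phi (x, y))); last first.
  by move=> y _; rewrite KE KE'.
rewrite RintegralB//; [|exact: (bounded_integrable mu'T (mI K) (bI K))|
  exact: (bounded_integrable mu'T (mI K') (bI K'))].
(* Only [F'] disintegrates [P'] over [mu']; the term with [F] must first be moved to [mu], where it
   becomes the integral against [P]. *)
have d' : \int[P']_p phi p = \int[mu']_y \int[K' y]_x phi (x, y).
  apply: (Rintegral_disintegration _ mphi phi1) => A B mA mB.
  by rewrite FE'//; apply: eq_integral => y _; rewrite KE'.
have d : \int[P]_p phi p = \int[mu]_y \int[K y]_x phi (x, y).
  apply: (Rintegral_disintegration _ mphi phi1) => A B mA mB.
  by rewrite FE//; apply: eq_integral => y _; rewrite KE.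
rewrite -d'.
have := obs_law_TV TT' QQ' (prob_measure z) u (mI K) (bI K).
have := joint_law_TV TT' QQ' (prob_measure z) u mphi phi1.
rewrite -/mu -/mu' -/P -/P' d distrC mul1r => hp; rewrite distrC => ha.
rewrite mulr_natl mulr2n -(subrKA (\int[mu]_y \int[K y]_x phi (x, y))).
by apply: lerD; apply: le_trans (ler_norm _) _; rewrite // distrC.
Qed.

Lemma BL_filter_le (f : prob_space X -> R) : BL_ball (@rho_BL R X) f ->
  `|\int[mu]_y f (F y) - \int[mu']_y f (F' y)| <= 2 * (cT + cQ).
Proof.
move=> BLf.
have [g BLg gP] := BL_countable sepX.
have [a [b [a0 b0 ab fa fb]]] := BL_prob_spaceP (conj BLg gP) BLf.
have mf := measurable_BL_version rF BLf.
have mf' := measurable_BL_version rF' BLf.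
have [mF _] := rF; have [mF' _] := rF'.
have mu'T : mu' setT = 1%E by exact: obs_law_setT.
have g1 k x : `|g k x| <= 1 by have [] := BL_edistP (BLg k).
pose c k y := \int[prob_measure (F y)]_x g k x - \int[prob_measure (F' y)]_x g k x.
have mc k : measurable_fun setT (c k).
  apply: measurable_funB.
    apply: (measurable_Rintegral_kernel _ mF (BL_measurable (BLg k)) (g1 k)) => y.
    exact: prob_measureT.
  apply: (measurable_Rintegral_kernel _ mF' (BL_measurable (BLg k)) (g1 k)) => y.
  exact: prob_measureT.
apply/ler_addgt0Pr => e e0.
(* The observations at which [g k] is good enough. They cover [Y], and choosing the first such [k]
   gives the test function [phi (x, y) = g (kk y) x], measurable in both variables. *)
pose B k := [set y | `|f (F y) - f (F' y)| - b * c k y <= e].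
have mB k : measurable (B k).
  rewrite (_ : B k = setT `&`
    (fun y => `|f (F y) - f (F' y)| - b * c k y) @^-1` `]-oo, e]).
    apply: measurable_funB => //.
      apply: measurableT_comp => //; exact: measurable_funB.
    exact: measurable_funM.
  by rewrite setTI; apply/seteqP; split => y /=; rewrite in_itv.
have BT : \bigcup_k B k = setT.
  apply/seteqP; split => // y _; have [k fk] := fb (F y) (F' y) e e0.
  by exists k => //; rewrite /B/= lerBlDl.
have [kk kkB mkk] := measurable_first_index mB BT.
have mphi := measurable_countable_selection (X := borel X)
  (fun k => BL_measurable (BLg k)) mkk.
pose psi y := c (kk y) y.
have psi_le : \int[mu']_y psi y <= 2 * (cT + cQ).
  exact: (Rintegral_version_diff mphi (fun p => g1 _ _)).
have mpsi : measurable_fun setT psi.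
  (* The index and the argument of [c] both vary with [y]: [psi] is the selection of the [c k]
     restricted to the diagonal. *)
  have msel := measurable_countable_selection mc mkk.
  have mdiag : measurable_fun setT (fun y : Y => (y, y)).
    exact: measurable_fun_pair.
  exact: (measurableT_comp msel mdiag).
have psi2 y : `|psi y| <= 1 + 1.
  apply: (le_trans (ler_normB _ _)); apply: lerD;
    by apply: norm_Rintegral_le => //; [exact: prob_measureT|exact: BL_measurable].
have ipsi := bounded_integrable mu'T mpsi psi2.
have fF := bounded_integrable mu'T mf (fun y => fa (F y)).
have fF' := bounded_integrable mu'T mf' (fun y => fa (F' y)).
have mdiff : measurable_fun setT (fun y => f (F y) - f (F' y)).
  exact: measurable_funB.
have dle y : `|f (F y) - f (F' y)| <= a + a.
  by apply: (le_trans (ler_normB _ _)); apply: lerD.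
have mbpsi : measurable_fun setT (fun y => b * psi y + e).
  by apply: measurable_funD => //; exact: measurable_funM.
have part2 : `|\int[mu']_y f (F y) - \int[mu']_y f (F' y)| <= b * (2 * (cT + cQ)) + e.
  rewrite -RintegralB//.
  apply: (le_trans (le_normr_Rintegral _ (bounded_integrable mu'T mdiff dle))) => //.
  apply: (@le_trans _ _ (\int[mu']_y (b * psi y + e))).
    apply: le_Rintegral => //.
    - apply: (bounded_integrable mu'T (f := fun y => `|f (F y) - f (F' y)|) (M := a + a)).
        exact: measurableT_comp.
      by move=> y; rewrite normr_id.
    - apply: (bounded_integrable mu'T mbpsi (M := b * (1 + 1) + e)) => y.
      apply: (le_trans (ler_normD _ _)); apply: lerD; last by rewrite ger0_norm// ltW.
      by rewrite normrM ger0_norm// ler_wpM2l.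
    - by move=> y _; rewrite -lerBlDl; exact: kkB.
  have ibpsi : mu'.-integrable setT (EFin \o (fun y => b * psi y)).
    apply: (bounded_integrable mu'T (f := fun y => b * psi y) (M := b * (1 + 1))).
      exact: measurable_funM.
    by move=> y; rewrite normrM ger0_norm// ler_wpM2l.
  rewrite RintegralD//; last by apply: (bounded_integrable mu'T (f := cst e) (M := `|e|)).
  by rewrite RintegralZl// Rintegral_cst// mu'T mulr1 lerD2r ler_wpM2l.
have part1 := obs_law_TV TT' QQ' (prob_measure z) u mf (fun y => fa (F y)).
have D0 : 0 <= cT + cQ by exact: addr_ge0.
apply: (@le_trans _ _ (a * (cT + cQ) + (b * (2 * (cT + cQ)) + e))).
  rewrite -(subrKA (\int[mu']_y f (F y))).
  by apply: (le_trans (ler_normD _ _)); exact: lerD.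
(* What remains is [a + 2 b <= 2], from [a + b <= 1] and [a >= 0]. *)
rewrite addrA lerD2r mulrA -mulrDl ler_wpM2r//.
lra.
Qed.

End filter_comparison.

Lemma Rintegral_BL_filter_kernel {R : realType} {X : completeMetricType R}
    {dY} {Y : measurableType dY} {dU} {U : measurableType dU}
    (T : R.-pker (borel X * U)%type ~> borel X) (Q : R.-pker borel X ~> Y)
    (eta : R.-pker (prob_space X * U)%type ~> prob_space X) :
  separable X -> is_filter_kernel T Q eta ->
  exists F : prob_space X -> U -> Y -> prob_space X, forall z u,
    regular_conditional T Q z u (F z u) /\
    forall f : prob_space X -> R, BL_ball (@rho_BL R X) f ->
      (\int[eta (z, u)]_mu (f mu)%:E)%E =
      (\int[obs_law T Q (prob_measure z) u]_y f (F z u y))%:E.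
Proof.
move=> sX [F [rF etaE]]; exists F => z u; split; first exact: rF.
move=> f BLf.
have etaT : eta (z, u) setT = 1%E by exact: prob_kernel.
have [g gP] : exists g, BL_norming (g : nat -> X -> R).
  by have [g BLg gP] := BL_countable sX; exists g.
have [a [b [_ _ _ fa _]]] := BL_prob_spaceP gP BLf.
have mf : measurable_fun setT f.
  (* [f] is Lipschitz for [rho_BL], while the sigma-algebra comes from the weak topology; the
     McShane formula with [Phi = id] links the two. *)
  by apply: (BL_comp_measurable (Phi := id) sX) => // h; exact: measurable_prob_Rintegral.
have mfF := measurable_BL_version sX (rF z u) BLf.
rewrite (integral_EFin_bounded etaT mf fa).
by rewrite (Rintegral_filter_kernel (etaE z u) etaT mf mfF fa).
Qed.

Local Open Scope ereal_scope.

Theorem theorem3p1 (R : realType) (X : completeMetricType R)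
    (dY : measure_display) (Y : measurableType dY)
    (dU : measure_display) (U : measurableType dU)
    (T Tn : R.-pker (borel X * U)%type ~> borel X)
    (Q Qn : R.-pker borel X ~> Y)
    (eta eta_n : R.-pker (prob_space X * U)%type ~> prob_space X) :
  separable X -> standard_borel R Y ->
  is_filter_kernel T Q eta -> is_filter_kernel Tn Qn eta_n ->
  BL_dist_ker eta eta_n <= 2%:E * (TV_dist_ker Tn T + TV_dist_ker Qn Q).
Proof.
move=> sX _ /(Rintegral_BL_filter_kernel sX)[F FP].
move=> /(Rintegral_BL_filter_kernel sX)[Fn FnP].
have [cT -> [cT0 TT]] := TV_dist_kerP Tn T.
have [cQ -> [cQ0 QQ]] := TV_dist_kerP Qn Q.
apply: ge_ereal_sup => _ [[z u] _ <-]; apply: ge_ereal_sup => _ [f BLf <-].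
have [rF ->//] := FP z u; have [rFn ->//] := FnP z u.
(* The total variation distances are taken from the [n]-th model to the limit model, so the two
   filters are compared in that order. *)
rewrite -EFinB abse_EFin lee_fin distrC.
exact: (BL_filter_le TT QQ cT0 cQ0 sX rFn rF BLf).
Qed.
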